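(* Let $R$ be a commutative ring containing a field of positive characteristic $p$ and let $N\subseteq M$ be $R$-modules. Then the Frobenius closure $N^F$ of $N$ in $M$ equals the closure of $N$ in $M$ induced by the Frobenius topology on $\operatorname{Spec} R$.
   Context: For $e\in\mathbb N$ let ${}^eR$ be the ring $R$ considered as an $R$-algebra via the $e$-th iterate of the Frobenius homomorphism $f\mapsto f^{p}$, and ${}^eM=M\otimes_R{}^eR$. The Frobenius closure of $N\subseteq M$ is $N^F=\{s\in M:\exists e\in\mathbb N\text{ such that }s\otimes 1\in\operatorname{im}({}^eN\to{}^eM)\}$. For a scheme $U$ of characteristic $p$ let ${}^eU\to U$ be the $e$-th iterate of the absolute Frobenius morphism. A finite morphism $V\to U$ (of finite type) of schemes of characteristic $p$ is a finite Frobenius cover if there are $e\in\mathbb N$ and a factorization ${}^eU\to V\to U$ of the $e$-th iterate of the absolute Frobenius such that ${}^eU\to V$ is surjective. Frobenius topology on a scheme $X$ of characteristic $p$: the category consists of schemes over $X$ where all morphisms $V\to U$ (including the structural morphisms $V\to X$) are finite Frobenius covers; each such single morphism is a covering. Closure induced by an affine Grothendieck topology on $X=\operatorname{Spec} R$: for an $R$-module $M$ let $M_{\mathrm{top}}$ be the sheafification of the presheaf $\operatorname{Spec} S\mapsto M\otimes_R S$, with sheafification map $\theta:M\to\Gamma(X_{\mathrm{top}},M_{\mathrm{top}})$. For $N\subseteq M$ let $N^{\mathrm{top}}$ be the image sheaf of $N_{\mathrm{top}}\to M_{\mathrm{top}}$; the induced closure is $\theta^{-1}(\Gamma(X_{\mathrm{top}},N^{\mathrm{top}}))\subseteq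 M$. *)

(* Defs.v *)
From HB Require Import structures.
From mathcomp Require Import all_boot all_order all_algebra ring_quotient.
From mathcomp Require Import boolp classical_sets.
From mathcomp.multinomials Require Import freeg.

Set Implicit Arguments.
Unset Strict Implicit.
Unset Printing Implicit Defensive.

Import GRing.Theory.
Import Quotient.Exports.

Local Open Scope ring_scope.
Local Open Scope quotient_scope.
Local Open Scope classical_set_scope.

Section Submodule.
Variables (R : pzRingType) (M : lmodType R) (N : submodClosed M).

Record submod_of := SubmodOf { submod_elt : M; _ : submod_elt \in N }.

HB.instance Definition _ := [isSub for submod_elt].
HB.instance Definition _ := [Choice of submod_of by <:].
HB.instance Definition _ := [SubChoice_isSubLmodule of submod_of by <:].

Definition submod_incl : {linear submod_of -> M} := val.
End Submodule.

(* The tensor product M (x)_R S, where S is the R-algebra given by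
   [phi : R -> S]: the free abelian group on M * S modulo the subgroup generated
   by the biadditivity and R-balancedness relations. *)
Section Tensor.
Variables (R : comNzRingType) (M : lmodType R) (S : comNzRingType).
Variable phi : {rmorphism R -> S}.

Local Notation free := {freeg (M * S)%type / int}.
Local Notation gen m s := (<< (m, s) >> : free).

Inductive tensor_rel : free -> Prop :=
| tensor_rel0 : tensor_rel 0
| tensor_relB x y : tensor_rel x -> tensor_rel y -> tensor_rel (x - y)
| tensor_relDl m m' s : tensor_rel (gen (m + m') s - gen m s - gen m' s)
| tensor_relDr m s s' : tensor_rel (gen m (s + s') - gen m s - gen m s')
| tensor_relZ r m s : tensor_rel (gen (r *: m) s - gen m (phi r * s)).

Definition tensor_pred : {pred free} := fun x => `[< tensor_rel x >].

Lemma tensor_pred_closed : zmod_closed tensor_pred.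
Proof.
split; first by apply/asboolP; exact: tensor_rel0.
by move=> x y /asboolP hx /asboolP hy; apply/asboolP; exact: tensor_relB.
Qed.

HB.instance Definition _ :=
  GRing.isZmodClosed.Build free tensor_pred tensor_pred_closed.

Definition tensor : zmodType := Quotient.quot tensor_pred.

Definition tensor_pi : {additive free -> tensor} :=
  \pi_(Quotient.quot tensor_pred).

Definition tens (m : M) (s : S) : tensor := tensor_pi (gen m s).

Lemma tensor_pi_eq0 x : tensor_rel x -> tensor_pi x = 0.
Proof.
move=> hx; rewrite -[RHS](raddf0 tensor_pi); apply/eqP.
by rewrite -Quotient.idealrBE subr0; apply/asboolP.
Qed.

Lemma tensor_pi_eq x y : tensor_pi x = tensor_pi y -> tensor_rel (x - y).
Proof. by move=> /eqP; rewrite -Quotient.idealrBE => /asboolP. Qed.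

Lemma tensor_pi_surj t : exists x, t = tensor_pi x.
Proof. by elim/quotW: t => x; exists x. Qed.

Lemma tensDl m m' s : tens (m + m') s = tens m s + tens m' s.
Proof.
have := tensor_pi_eq0 (tensor_relDl m m' s); rewrite 2!(raddfB tensor_pi).
by rewrite /tens => /eqP; rewrite subr_eq add0r subr_eq => /eqP ->; exact: addrC.
Qed.

Lemma tensDr m s s' : tens m (s + s') = tens m s + tens m s'.
Proof.
have := tensor_pi_eq0 (tensor_relDr m s s'); rewrite 2!(raddfB tensor_pi).
by rewrite /tens => /eqP; rewrite subr_eq add0r subr_eq => /eqP ->; exact: addrC.
Qed.

Lemma tensZ r m s : tens (r *: m) s = tens m (phi r * s).
Proof.
have := tensor_pi_eq0 (tensor_relZ r m s); rewrite (raddfB tensor_pi).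
by move=> /eqP; rewrite subr_eq0 => /eqP.
Qed.

Section Lift.
Variables (V : zmodType) (h : M -> S -> V).
Hypothesis hDl : forall m m' s, h (m + m') s = h m s + h m' s.
Hypothesis hDr : forall m s s', h m (s + s') = h m s + h m s'.
Hypothesis hZ : forall r m s, h (r *: m) s = h m (phi r * s).

Definition free_lift (x : free) : V := fglift (fun z => h z.1 z.2 : zmodule V) x.

Lemma free_lift_is_zmod_morphism : zmod_morphism free_lift.
Proof. exact: (@lift_is_additive int _ (zmodule V)). Qed.

HB.instance Definition _ :=
  GRing.isZmodMorphism.Build free V free_lift free_lift_is_zmod_morphism.

Lemma free_lift_gen m s : free_lift (gen m s) = h m s.
Proof. by rewrite /free_lift liftU scale1r. Qed.

Lemma free_lift_rel x : tensor_rel x -> free_lift x = 0.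
Proof.
elim=> [|{}x y _ hx _ hy|m m' s|m s s'|r m s]; rewrite ?raddf0 ?raddfB //=.
- by rewrite hx hy subrr.
- by rewrite !free_lift_gen hDl addrAC addrK subrr.
- by rewrite !free_lift_gen hDr addrAC addrK subrr.
- by rewrite !free_lift_gen hZ subrr.
Qed.

Definition tensor_lift (t : tensor) : V :=
  free_lift (repr (t : Quotient.quot tensor_pred)).

Lemma tensor_lift_pi x : tensor_lift (tensor_pi x) = free_lift x.
Proof.
apply/eqP; rewrite -subr_eq0 -raddfB; apply/eqP/free_lift_rel/tensor_pi_eq.
exact: reprK.
Qed.

Lemma tensor_lift_is_zmod_morphism : zmod_morphism tensor_lift.
Proof.
move=> t u; have [x ->] := tensor_pi_surj t; have [y ->] := tensor_pi_surj u.
by rewrite -raddfB !tensor_lift_pi raddfB.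
Qed.

Lemma tensor_lift_tens m s : tensor_lift (tens m s) = h m s.
Proof. by rewrite tensor_lift_pi free_lift_gen. Qed.
End Lift.

Lemma tensor_eq_morph (V : zmodType) (f g : {additive tensor -> V}) :
  (forall m s, f (tens m s) = g (tens m s)) -> f =1 g.
Proof.
move=> fg t; have [x ->] := tensor_pi_surj t.
rewrite -(freeg_sumE x) !raddf_sum; apply: eq_bigr => -[m s] _.
have -> : << coeff (m, s) x *g (m, s) >> = gen m s *~ coeff (m, s) x.
  by rewrite freeg_mulz intz.
by rewrite !raddfMz fg.
Qed.

End Tensor.

Section TensorMap.
Variables (R : comNzRingType) (N M : lmodType R) (f : {linear N -> M}).
Variables (S T : comNzRingType) (phi : {rmorphism R -> S}).
Variables (psi : {rmorphism R -> T}) (g : {rmorphism S -> T}).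
Hypothesis gphi : forall r, g (phi r) = psi r.

Let h n s := tens psi (f n) (g s).

Let hDl n n' s : h (n + n') s = h n s + h n' s.
Proof. by rewrite /h raddfD tensDl. Qed.

Let hDr n s s' : h n (s + s') = h n s + h n s'.
Proof. by rewrite /h raddfD tensDr. Qed.

Let hZ r n s : h (r *: n) s = h n (phi r * s).
Proof. by rewrite /h linearZ /= tensZ rmorphM gphi. Qed.

(* The unused argument says that g is an R-algebra map, without which the formula
   does not respect the relations of N (x)_R S. *)
Definition tensor_map of (forall r, g (phi r) = psi r) :
  tensor N phi -> tensor M psi := tensor_lift h.

HB.instance Definition _ :=
  GRing.isZmodMorphism.Build (tensor N phi) (tensor M psi) (tensor_map gphi)
    (tensor_lift_is_zmod_morphism hDl hDr hZ).

Lemma tensor_map_tens n s :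
  tensor_map gphi (tens phi n s) = tens psi (f n) (g s).
Proof. exact: tensor_lift_tens hDl hDr hZ n s. Qed.

End TensorMap.

Section Frobenius.
Variable p : nat.

Definition frobenius_iter (A : comNzRingType) (charA : p \in [pchar A])
  (e : nat) : A -> A := iter e (pFrobenius_aut charA).

Section Morphism.
Variables (A : comNzRingType) (charA : p \in [pchar A]) (e : nat).

Lemma frobenius_iter_is_zmod_morphism : zmod_morphism (frobenius_iter charA e).
Proof.
move=> x y; rewrite /frobenius_iter; elim: e => //= n ->; exact: raddfB.
Qed.

Lemma frobenius_iter_is_monoid_morphism :
  monoid_morphism (frobenius_iter charA e).
Proof.
rewrite /frobenius_iter; split; first by elim: e => //= n ->; exact: rmorph1.
by move=> x y; elim: e => //= n ->; exact: rmorphM.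
Qed.

HB.instance Definition _ := GRing.isZmodMorphism.Build A A
  (frobenius_iter charA e) frobenius_iter_is_zmod_morphism.
HB.instance Definition _ := GRing.isMonoidMorphism.Build A A
  (frobenius_iter charA e) frobenius_iter_is_monoid_morphism.
End Morphism.

Lemma frobenius_iter_morph (A B : comNzRingType) (charA : p \in [pchar A])
    (charB : p \in [pchar B]) (f : {rmorphism A -> B}) e x :
  f (frobenius_iter charA e x) = frobenius_iter charB e (f x).
Proof. by rewrite /frobenius_iter; elim: e => //= n <-; exact: rmorphXn. Qed.

(* eN and eM are tensor products over R with the R-algebra R whose structure map
   is the e-th iterate of the Frobenius. *)
Definition frobenius_closure (R : comNzRingType) (charR : p \in [pchar R])
    (M : lmodType R) (N : submodClosed M) : set M :=
  [set s | exists e : nat,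
     range (@tensor_map R (submod_of N) M (submod_incl N) R R
              (frobenius_iter charR e) (frobenius_iter charR e) idfun
              (fun=> erefl))
       (tens (frobenius_iter charR e) s 1)].

(* [phi : A -> B] makes Spec B -> Spec A a finite morphism. *)
Definition finite_rmorphism (A B : comNzRingType) (phi : {rmorphism A -> B}) :=
  exists (n : nat) (b : 'I_n -> B),
    forall x : B, exists a : 'I_n -> A, x = \sum_(i < n) phi (a i) * b i.

(* [psi : B -> A] makes Spec A -> Spec B surjective. *)
Definition spec_surjective (B A : comNzRingType) (psi : {rmorphism B -> A}) :=
  forall Q : prime_idealr B, exists P : prime_idealr A,
    forall b : B, (b \in Q) = (psi b \in P).

(* With U = Spec A, V = Spec B: the finite morphism V -> U given by phi and the
   factorisation eU -> V -> U of the Frobenius given by psi. *)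
Definition finite_frobenius_cover (A B : comNzRingType)
    (charA : p \in [pchar A]) (phi : {rmorphism A -> B}) :=
  finite_rmorphism phi /\
  exists (e : nat) (psi : {rmorphism B -> A}),
    (forall a, psi (phi a) = frobenius_iter charA e a) /\ spec_surjective psi.

Lemma finite_frobenius_cover_id (A : comNzRingType) (charA : p \in [pchar A]) :
  finite_frobenius_cover charA (idfun : {rmorphism A -> A}).
Proof.
split.
  by exists 1, (fun=> 1) => x; exists (fun=> x); rewrite big_ord1 mulr1.
by exists 0, idfun; split=> // Q; exists Q.
Qed.

Lemma finite_frobenius_cover_comp (A B C : comNzRingType)
    (charA : p \in [pchar A]) (charB : p \in [pchar B])
    (phi : {rmorphism A -> B}) (phi' : {rmorphism B -> C}) :
  finite_frobenius_cover charA phi -> finite_frobenius_cover charB phi' ->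
  finite_frobenius_cover charA (phi' \o phi).
Proof.
move=> [[n [b hb]] [e [psi [hpsi spsi]]]] [[n' [c hc]] [e' [psi' [hpsi' spsi']]]].
split.
  exists #|{: 'I_n * 'I_n'}|.
  exists (fun k => phi' (b (enum_val k).1) * c (enum_val k).2) => x.
  have [d ->] := hc x; have /fin_all_exists[a ha] := fun j => hb (d j).
  exists (fun k => a (enum_val k).2 (enum_val k).1).
  rewrite -(big_enum_val
    (fun k : 'I_n * 'I_n' => phi' (phi (a k.2 k.1)) * (phi' (b k.1) * c k.2))) /=.
  rewrite -(pair_bigA _ (fun i j => phi' (phi (a j i)) * (phi' (b i) * c j))) /=.
  rewrite exchange_big; apply: eq_bigr => j _; rewrite ha rmorph_sum mulr_suml.
  by apply: eq_bigr => i _; rewrite rmorphM mulrA.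
exists (e' + e)%N, (psi \o psi'); split.
  by move=> a; rewrite /= hpsi' (frobenius_iter_morph charB charA) hpsi
    /frobenius_iter -iterD.
move=> Q; have [P hP] := spsi' Q; have [P' hP'] := spsi P.
by exists P' => z; rewrite hP hP'.
Qed.

End Frobenius.

(* The Frobenius topology on Spec R. A finite morphism to an affine scheme has
   affine source, so the objects are the Spec S for R-algebras S whose structure
   map is a finite Frobenius cover. (S is nonzero as S maps to R.) *)
Section FrobeniusSite.
Variables (p : nat) (R : comNzRingType) (charR : p \in [pchar R]).

Record site_obj := SiteObj {
  site_ring :> comNzRingType;
  site_str : {rmorphism R -> site_ring};
  site_obj_cover : finite_frobenius_cover charR site_str }.

Definition site_char (U : site_obj) : p \in [pchar U] :=
  rmorph_pchar (site_str U) charR.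

(* A morphism V -> U over Spec R, i.e. an R-algebra map in the other
   direction. *)
Record site_hom (V U : site_obj) := SiteHom {
  site_map :> {rmorphism U -> V};
  site_mapE : forall r, site_map (site_str U r) = site_str V r;
  site_hom_cover : finite_frobenius_cover (site_char U) site_map }.

Definition site_top : site_obj :=
  SiteObj (finite_frobenius_cover_id charR).

Definition site_id (U : site_obj) : site_hom U U :=
  @SiteHom U U idfun (fun=> erefl) (finite_frobenius_cover_id (site_char U)).

Lemma site_comp_mapE (W V U : site_obj) (f : site_hom V U) (g : site_hom W V) r :
  (site_map g \o site_map f) (site_str U r) = site_str W r.
Proof. by rewrite /= !site_mapE. Qed.

(* The composite W -> V -> U. *)
Definition site_comp (W V U : site_obj) (f : site_hom V U) (g : site_hom W V) :
    site_hom W U :=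
  @SiteHom W U (site_map g \o site_map f) (site_comp_mapE f g)
    (finite_frobenius_cover_comp (site_hom_cover f) (site_hom_cover g)).

Record presheaf := Presheaf {
  sections :> site_obj -> zmodType;
  restr : forall V U, site_hom V U -> {additive sections U -> sections V};
  restr_id : forall U (x : sections U), restr (site_id U) x = x;
  restr_comp : forall W V U (f : site_hom V U) (g : site_hom W V)
    (x : sections U), restr (site_comp f g) x = restr g (restr f x) }.
Arguments restr {_ _ _} _.

Record presheaf_hom (F G : presheaf) := PresheafHom {
  sect_map :> forall U, {additive F U -> G U};
  sect_map_restr : forall V U (f : site_hom V U) (x : F U),
    sect_map V (restr f x) = restr f (sect_map U x) }.

(* Every single morphism c : V -> U is a covering; its matching families are the
   sections over V whose pull-backs along any two a, b : T -> V with
   c \o a = c \o b agree. *)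
Definition is_sheaf (F : presheaf) :=
  forall V U (c : site_hom V U),
    injective (@restr F V U c) /\
    forall s : F V,
      (forall T (a b : site_hom T V), (forall x : U, a (c x) = b (c x)) ->
         restr a s = restr b s) ->
      exists t : F U, restr c t = s.

Record sheafification (F : presheaf) := Sheafification {
  sheafified :> presheaf;
  sheafified_is_sheaf : is_sheaf sheafified;
  sheafify : presheaf_hom F sheafified;
  sheafify_univ : forall G, is_sheaf G -> forall f : presheaf_hom F G,
    exists g : presheaf_hom sheafified G,
      (forall U x, g U (sheafify U x) = f U x) /\
      forall g' : presheaf_hom sheafified G,
        (forall U x, g' U (sheafify U x) = f U x) ->
        forall U y, g' U y = g U y }.

Section TensorPresheaf.
Variable M : lmodType R.

Let res V U (f : site_hom V U) :
    {additive tensor M (site_str U) -> tensor M (site_str V)} :=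
  tensor_map idfun (site_mapE f).

Let res_id U (x : tensor M (site_str U)) : res (site_id U) x = x.
Proof.
apply: (tensor_eq_morph (f := res (site_id U)) (g := idfun)) => m s.
by rewrite /= tensor_map_tens.
Qed.

Let res_comp W V U (f : site_hom V U) (g : site_hom W V)
  (x : tensor M (site_str U)) : res (site_comp f g) x = res g (res f x).
Proof.
apply: (tensor_eq_morph (f := res (site_comp f g)) (g := res g \o res f)) => m s.
by rewrite /= !tensor_map_tens.
Qed.

Definition tensor_presheaf : presheaf := Presheaf res_id res_comp.
End TensorPresheaf.

Section TensorPresheafMap.
Variables (N M : lmodType R) (f : {linear N -> M}).

Let fU (U : site_obj) : {additive tensor_presheaf N U -> tensor_presheaf M U} :=
  @tensor_map _ _ _ f _ _ (site_str U) (site_str U) idfun (fun=> erefl).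

Let fU_restr V U (c : site_hom V U) (x : tensor_presheaf N U) :
  fU V (restr c x) = restr c (fU U x).
Proof.
apply: (tensor_eq_morph (f := fU V \o restr c) (g := restr c \o fU U)) => m s.
by rewrite /= !tensor_map_tens.
Qed.

Definition tensor_presheaf_map :
  presheaf_hom (tensor_presheaf N) (tensor_presheaf M) := PresheafHom fU_restr.
End TensorPresheafMap.

Definition presheaf_hom_comp (F G H : presheaf) (g : presheaf_hom G H)
    (f : presheaf_hom F G) : presheaf_hom F H.
Proof.
exists (fun U => g U \o f U) => V U c x /=.
by rewrite !sect_map_restr.
Defined.

Definition sheafify_map (F G : presheaf) (F' : sheafification F)
    (G' : sheafification G) (f : presheaf_hom F G) : presheaf_hom F' G' :=
  projT1 (cid (sheafify_univ F' (sheafified_is_sheaf G')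
                 (presheaf_hom_comp (sheafify G') f))).

(* The subsheaf of G whose sections are those locally in the image of f; here
   locally means after pull-back along some covering V -> U. *)
Definition image_sheaf (F G : presheaf) (f : presheaf_hom F G) (U : site_obj) :
    set (G U) :=
  [set t | exists (V : site_obj) (c : site_hom V U), range (f V) (restr c t)].

Section Closure.
Variables (M : lmodType R) (N : submodClosed M).
Variable Mtop : sheafification (tensor_presheaf M).
Variable Ntop : sheafification (tensor_presheaf (submod_of N)).

(* M = M (x)_R R -> Gamma(Spec R, Mtop) *)
Definition theta (s : M) : Mtop site_top :=
  sheafify Mtop site_top (tens (site_str site_top) s 1).

Definition frobenius_top_closure : set M :=
  theta @^-1`
    @image_sheaf Ntop Mtop
      (sheafify_map Ntop Mtop (tensor_presheaf_map (submod_incl N))) site_top.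
End Closure.

End FrobeniusSite.

(* Main.v *)
(** The Frobenius closure is contained in the topological one because every
    relation in [M (x)_R eR] involves finitely many scalars: it already holds over
    a subring [S] of [eR] which is a finite [R]-algebra, and [Spec S -> Spec R] is
    a Frobenius cover, with [S -> R] as factor of the Frobenius.

    For the converse, consider the quotient of the product of all
    [M (x)_R iR], [i : nat], by the families that eventually lie in the image of
    [N (x)_R iR]. As a constant presheaf it is a sheaf for the Frobenius topology.
    The factorisations [R -> S -> R] of powers of the Frobenius map [M (x)_R S] to
    it, and naturally so: [S -> R] is surjective on spectra, so its kernel is nil,
    which makes it unique up to powers of the Frobenius. By the universal property
    this extends to the sheafification of [M], where it vanishes on the image of
    the sheafification of [N]. Hence an element of the topological closure becomes
    zero in the quotient, which says that it lies in the Frobenius closure. *)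

Require Import Defs.
From HB Require Import structures.
From mathcomp Require Import all_boot all_order all_algebra.
From mathcomp Require Import ring_quotient zify.
From mathcomp Require Import boolp classical_sets functions.
From mathcomp.multinomials Require Import freeg.

Set Implicit Arguments.
Unset Strict Implicit.
Unset Printing Implicit Defensive.

Import GRing.Theory.
Import Quotient.Exports.
Local Open Scope ring_scope.

(** * Surjectivity on spectra forces a nil kernel *)

Section PrimeAvoidance.
Variables (B : comNzRingType) (b : B).
Hypothesis b_pow_neq0 : forall n, b ^+ n != 0.

(* Zero is not required to belong to the set, so that the union of the empty
   chain qualifies. *)
Let avoiding (X : set B) : Prop :=
  [/\ forall x y, X x -> X y -> X (x + y), forall r x, X x -> X (r * x)
    & forall n, ~ X (b ^+ n)].

Let avoiding_bigcup (F : set (set B)) :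
  (F `<=` avoiding)%classic -> total_on F subset ->
  avoiding (\bigcup_(X in F) X)%classic.
Proof.
move=> FP Ftot; split.
- move=> x y [X FX Xx] [Y FY Yy].
  case: (Ftot _ _ FX FY) => [XY | YX].
    by exists Y => //; have [+ _ _] := FP _ FY; apply=> //; exact: XY.
  by exists X => //; have [+ _ _] := FP _ FX; apply=> //; exact: YX.
- by move=> r x [X FX Xx]; exists X => //; have [_ + _] := FP _ FX; apply.
- by move=> n [X FX]; have [_ _ +] := FP _ FX; apply.
Qed.

(** Krull's argument: Zorn gives a maximal [A] among the sets that satisfy [avoiding], and
    maximality makes it a prime ideal. *)
Lemma prime_avoiding_powers : exists P : prime_idealr B, b \notin P.
Proof.
have [A [[AD AM Ab] Amax]] := Zorn_bigcup avoiding_bigcup.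
(* A nonempty [A] contains [0 * x]; an empty one would lie strictly below the zero ideal. *)
have A0 : A 0.
  apply: contrapT => nA0.
  have A_empty x : ~ A x by move=> /(AM 0); rewrite mul0r.
  apply: (Amax [set 0]%classic).
    by split=> [x /A_empty//|/(_ 0 erefl)/A_empty].
  split=> [x y -> ->|r x ->|n /eqP]; rewrite ?addr0 ?mulr0 //.
  by rewrite (negPf (b_pow_neq0 n)).
(* For [x] outside [A], the ideal [A + B x], written as the [y] with some [y - c * x] in [A], is
   strictly larger, so it meets the powers of [b]. *)
have A_pow x : ~ A x -> exists n c, A (b ^+ n - c * x).
  move=> nAx; apply: contrapT => H.
  apply: (Amax (fun y => exists c, A (y - c * x))).
    split=> [y Ay|/(_ x) AX]; first by exists 0; rewrite mul0r subr0.
    by apply/nAx/AX; exists 1; rewrite mul1r subrr.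
  split=> [y z [c Ac] [d Ad]|r y [c Ac]|n [c Ac]].
  - exists (c + d); have -> : y + z - (c + d) * x = (y - c * x) + (z - d * x).
      by rewrite mulrDl opprD addrACA.
    exact: AD.
  - by exists (r * c); rewrite -mulrA -mulrBr; exact: AM.
  - by apply: H; exists n, c.
have A_prime x y : A (x * y) -> A x \/ A y.
  move=> Axy; apply: contrapT => /not_orP[/A_pow[n [c Ac]] /A_pow[m [d Ad]]].
  (* Modulo [A], [b ^+ n] is [c * x] and [b ^+ m] is [d * y], so [b ^+ (n + m)] is
     [c * d * (x * y)], that is, zero. *)
  apply: (Ab (n + m)).
  have -> : b ^+ (n + m) = b ^+ m * (b ^+ n - c * x)
      + (c * x * (b ^+ m - d * y) + c * d * (x * y)).
    by rewrite exprD !mulrBr mulrACA [in X in _ + X]subrK [c * x * _]mulrC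
      addrNK mulrC.
  by apply: (AD); [|apply: AD]; exact: AM.
pose S : {pred B} := fun x => `[< A x >].
have S_ideal : idealr_closed S.
  split; first exact/asboolP.
    by apply/asboolP; have := Ab 0%N; rewrite expr0.
  by move=> a u v /asboolP Au /asboolP Av; apply/asboolP/AD => //; exact: AM.
have S_prime : prime_idealr_closed S.
  move=> u v /asboolP /A_prime [Au|Av]; apply/orP; [left|right]; exact/asboolP.
pose P := HB.pack_for (prime_idealr B) S (isIdealr.Build B S S_ideal)
  (isPrimeIdealrClosed.Build B S S_prime).
by exists P; apply/asboolP; have := Ab 1%N; rewrite expr1.
Qed.
End PrimeAvoidance.

(** Every prime of [B] is the preimage of a prime of [A], hence contains the kernel; a non-nilpotent
    [b] would avoid one of them. *)
Lemma spec_surjective_ker (A B : comNzRingType) (psi : {rmorphism B -> A}) b :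
  spec_surjective psi -> psi b = 0 -> exists n, b ^+ n = 0.
Proof.
move=> psi_surj psib0; apply: contrapT => /forallNP b_pow.
have [|Q /negP bQ] := @prime_avoiding_powers B b; first by move=> n; apply/eqP.
by have [P hP] := psi_surj Q; apply: bQ; rewrite hP psib0 rpred0.
Qed.

(** * Uniqueness of factorisations up to powers of the Frobenius *)

Section FrobeniusIter.
Variable p : nat.

Lemma frobenius_iterE (A : comNzRingType) (charA : p \in [pchar A]) e x :
  frobenius_iter charA e x = x ^+ (p ^ e).
Proof.
rewrite /frobenius_iter; elim: e => [|e IHe] /=; first by rewrite expr1.
by rewrite IHe pFrobenius_autE -exprM expnSr.
Qed.

Lemma frobenius_iterD (A : comNzRingType) (charA : p \in [pchar A]) e e' x :
  frobenius_iter charA (e + e') x =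
  frobenius_iter charA e (frobenius_iter charA e' x).
Proof. exact: iterD. Qed.

Lemma frobenius_iter_nilpotent (A : comNzRingType) (charA : p \in [pchar A])
    (x : A) n : x ^+ n = 0 -> exists e, frobenius_iter charA e x = 0.
Proof.
move=> xn0; exists n; have p_gt1 := prime_gt1 (pcharf_prime charA).
by rewrite frobenius_iterE -(subnK (ltnW (ltn_expl n p_gt1))) exprD xn0 mulr0.
Qed.

Variables (A B : comNzRingType).
Variables (charA : p \in [pchar A]) (charB : p \in [pchar B]).
Variables (phi : {rmorphism A -> B}) (psi : {rmorphism B -> A}) (e : nat).
Hypothesis psi_phi : forall a, psi (phi a) = frobenius_iter charA e a.
Hypothesis psi_surj : spec_surjective psi.

(** [psi] sends both [phi (psi u)] and the [e]-th Frobenius of [u] to the [e]-th Frobenius of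
    [psi u]. The difference is thus nilpotent, and [c] further iterates kill it. *)
Lemma cover_section_frobenius u : exists c,
  frobenius_iter charB c (phi (psi u)) = frobenius_iter charB (c + e) u.
Proof.
have [|n un0] :=
  spec_surjective_ker (b := phi (psi u) - frobenius_iter charB e u) psi_surj.
  by rewrite rmorphB /= psi_phi (frobenius_iter_morph charB charA) subrr.
have [c /eqP] := frobenius_iter_nilpotent charB un0.
by rewrite rmorphB /= subr_eq0 -frobenius_iterD => /eqP; exists c.
Qed.

(** Apply [alpha] to the identity of [cover_section_frobenius], then iterate the Frobenius up to
    [i]. *)
Lemma cover_section_unique (alpha : {rmorphism B -> A}) e' u :
  (forall a, alpha (phi a) = frobenius_iter charA e' a) ->
  exists n0, forall i, (n0 <= i)%N ->
    frobenius_iter charA (i - e') (alpha u) =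
    frobenius_iter charA (i - e) (psi u).
Proof.
move=> alpha_phi; have [c hc] := cover_section_frobenius u.
(* From this bound on, [i - e] and [i - e'] are true differences. *)
exists (c + e + e')%N => i hi.
have /(congr1 alpha) := hc.
rewrite !(frobenius_iter_morph charB charA) alpha_phi -frobenius_iterD.
move=> /(congr1 (frobenius_iter charA (i - (c + e + e')))).
rewrite -!frobenius_iterD.
have -> : (i - (c + e + e') + (c + e') = i - e)%N by lia.
by have -> : (i - (c + e + e') + (c + e) = i - e')%N by lia.
Qed.
End FrobeniusIter.

Lemma free_eq_morph (R : comNzRingType) (M : lmodType R) (S : comNzRingType)
    (V : zmodType) (f g : {additive {freeg (M * S)%type / int} -> V}) :
  (forall m s, f << (m, s) >> = g << (m, s) >>) -> f =1 g.
Proof.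
move=> fg x; rewrite -(freeg_sumE x) !raddf_sum; apply: eq_bigr => -[m s] _.
have -> : << coeff (m, s) x *g (m, s) >> = << (m, s) >> *~ coeff (m, s) x
    :> {freeg (M * S)%type / int} by rewrite freeg_mulz intz.
by rewrite !raddfMz fg.
Qed.

Lemma tensor_presheaf_map_tens (p : nat) (R : comNzRingType)
    (charR : p \in [pchar R]) (N M : lmodType R) (f : {linear N -> M})
    (U : site_obj charR) n s :
  tensor_presheaf_map charR f U (tens (site_str U) n s) =
  tens (site_str U) (f n) s.
Proof. exact: tensor_map_tens. Qed.

Lemma sheafify_mapE (p : nat) (R : comNzRingType) (charR : p \in [pchar R])
    (F G : presheaf charR) (F' : sheafification F) (G' : sheafification G)
    (f : presheaf_hom F G) U x :
  sheafify_map F' G' f U (sheafify F' U x) = sheafify G' U (f U x).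
Proof.
exact: (projT2 (cid (sheafify_univ F' (sheafified_is_sheaf G')
  (presheaf_hom_comp (sheafify G') f)))).1.
Qed.

(** * The constant sheaf of eventual classes; the topological closure lies in the Frobenius
    closure *)

Section EventualQuotient.
Variables (p : nat) (R : comNzRingType) (charR : p \in [pchar R]).
Variables (M : lmodType R) (N : submodClosed M).

Local Notation F := (frobenius_iter charR).
Local Notation free := {freeg (M * R)%type / int}.

Definition frobenius_incl e :
    {additive tensor (submod_of N) (F e) -> tensor M (F e)} :=
  @tensor_map R (submod_of N) M (submod_incl N) R R (F e) (F e) idfun
    (fun=> erefl).

(** Families of representatives in the free group, whose type does not depend on [i]. Families of
    tensor relations belong to it too, since they represent zero. *)
Definition eventually_in_image : {pred nat -> free} := fun x =>
  `[< exists n0, forall i, (n0 <= i)%N ->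
        range (frobenius_incl i) (tensor_pi M (F i) (x i)) >].

Lemma eventually_in_image_closed : zmod_closed eventually_in_image.
Proof.
split; first by apply/asboolP; exists 0%N => i _; exists 0; rewrite ?raddf0.
move=> x y /asboolP[n hx] /asboolP[m hy]; apply/asboolP.
exists (n + m)%N => i hi.
have [t _ ht] := hx i (leq_trans (leq_addr _ _) hi).
have [u _ hu] := hy i (leq_trans (leq_addl _ _) hi).
by exists (t - u) => //; rewrite !raddfB ht hu.
Qed.

HB.instance Definition _ := GRing.isZmodClosed.Build (nat -> free)
  eventually_in_image eventually_in_image_closed.

Definition eventual_quot : zmodType := Quotient.quot eventually_in_image.

Definition eventual_pi : {additive (nat -> free) -> eventual_quot} :=
  \pi_(Quotient.quot eventually_in_image)%qT.

Lemma eventual_piP x y : eventual_pi x = eventual_pi y <->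
  exists n0, forall i, (n0 <= i)%N ->
    range (frobenius_incl i)
      (tensor_pi M (F i) (x i) - tensor_pi M (F i) (y i)).
Proof.
split=> [/eqP|[n0 hn0]].
  rewrite -Quotient.idealrBE => /asboolP[n0 hn0].
  by exists n0 => i /hn0; rewrite raddfB.
apply/eqP; rewrite -Quotient.idealrBE; apply/asboolP; exists n0 => i /hn0.
by rewrite raddfB.
Qed.

Lemma eventual_pi_eq x y :
  (exists n0, forall i, (n0 <= i)%N ->
     tensor_pi M (F i) (x i) = tensor_pi M (F i) (y i)) ->
  eventual_pi x = eventual_pi y.
Proof.
move=> [n0 xy]; apply/eventual_piP; exists n0 => i /xy ->.
by exists 0; rewrite // raddf0 subrr.
Qed.

Definition constant_presheaf (V : zmodType) : presheaf charR :=
  @Presheaf p R charR (fun=> V) (fun _ _ _ => idfun) (fun _ _ => erefl)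
    (fun _ _ _ _ _ _ => erefl).

Lemma constant_presheaf_is_sheaf V : is_sheaf (constant_presheaf V).
Proof. by move=> V' U c; split=> [x y //|s _]; exists s. Qed.

Section Comparison.
Variable U : site_obj charR.

Let cover := cid (site_obj_cover U).2.
Let e : nat := projT1 cover.
Let cover_psi := cid (projT2 cover).
Let psi : {rmorphism U -> R} := projT1 cover_psi.
Let psi_str : forall r, psi (site_str U r) = F e r := (projT2 cover_psi).1.
Let psi_surj : spec_surjective psi := (projT2 cover_psi).2.

(* The truncated difference is harmless: only large [i] matter. *)
Let h (m : M) (s : U) : eventual_quot :=
  eventual_pi (fun i => << (m, F (i - e) (psi s)) >>).

Let hDl m m' s : h (m + m') s = h m s + h m' s.
Proof.
rewrite /h -raddfD; apply: eventual_pi_eq; exists 0%N => i _.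
by rewrite raddfD; exact: (tensDl (F i)).
Qed.

Let hDr m s s' : h m (s + s') = h m s + h m s'.
Proof.
rewrite /h -raddfD; apply: eventual_pi_eq; exists 0%N => i _.
by rewrite !raddfD; exact: (tensDr (F i)).
Qed.

Let hZ r m s : h (r *: m) s = h m (site_str U r * s).
Proof.
apply: eventual_pi_eq; exists e => i ei; rewrite !rmorphM /= psi_str.
by rewrite -frobenius_iterD subnK //; exact: (tensZ (F i)).
Qed.

Definition comparison : tensor_presheaf charR M U -> eventual_quot :=
  tensor_lift h.

HB.instance Definition _ := GRing.isZmodMorphism.Build
  (tensor_presheaf charR M U) eventual_quot comparison
  (tensor_lift_is_zmod_morphism hDl hDr hZ).

(** By [cover_section_unique] every factorisation yields the same class, so the one picked by choice
    in [comparison] can be forgotten. *)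
Lemma comparison_tens e' (alpha : {rmorphism U -> R}) m s :
  (forall r, alpha (site_str U r) = F e' r) ->
  comparison (tens (site_str U) m s) =
  eventual_pi (fun i => << (m, F (i - e') (alpha s)) >>).
Proof.
move=> alpha_str; rewrite [LHS](tensor_lift_tens hDl hDr hZ).
have [n0 hn0] :=
  cover_section_unique (site_char U) psi_str psi_surj s alpha_str.
by apply: eventual_pi_eq; exists n0 => i /hn0 ->.
Qed.
End Comparison.

Lemma comparison_restr V U (c : site_hom V U) (x : tensor_presheaf charR M U) :
  comparison (restr _ c x) =
  restr (constant_presheaf eventual_quot) c (comparison x).
Proof.
rewrite /=.
apply: (tensor_eq_morph
  (f := @comparison V \o restr (tensor_presheaf charR M) c)
  (g := @comparison U)) => m s /=.
rewrite tensor_map_tens /=.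
have [_ [e [psi [psi_str _]]]] := site_obj_cover V.
(* A factorisation for [V] composed with [c] is one for [U] with the same exponent; both sides then
   have the same family. *)
rewrite (comparison_tens _ _ psi_str) (@comparison_tens U e (psi \o c)) //.
by move=> r; rewrite /= site_mapE.
Qed.

Definition comparison_hom :
    presheaf_hom (tensor_presheaf charR M) (constant_presheaf eventual_quot) :=
  @PresheafHom _ _ _ (tensor_presheaf charR M) (constant_presheaf eventual_quot)
    (fun U => @comparison U) comparison_restr.

Lemma comparison_submod U (x : tensor_presheaf charR (submod_of N) U) :
  comparison (tensor_presheaf_map charR (submod_incl N) U x) = 0.
Proof.
apply: (tensor_eq_morph
  (f := @comparison U \o tensor_presheaf_map charR (submod_incl N) U)
  (g := \0)) => n s /=.
rewrite tensor_presheaf_map_tens.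
have [_ [e [psi [psi_str _]]]] := site_obj_cover U.
rewrite (comparison_tens _ _ psi_str) -(raddf0 eventual_pi).
apply/eventual_piP; exists 0%N => i _.
exists (tens (F i) n (F (i - e) (psi s))) => //.
by rewrite raddf0 subr0; exact: tensor_map_tens.
Qed.

(** With the identity as factorisation, [s] is represented by the constant family [(s, 1)]; the
    bound for its vanishing is an exponent for the closure. *)
Lemma comparison_eq0 s :
  comparison (U := site_top charR) (tens (site_str (site_top charR)) s 1) = 0 ->
  frobenius_closure charR N s.
Proof.
rewrite (@comparison_tens (site_top charR) 0 idfun) // -(raddf0 eventual_pi).
move=> /eventual_piP[i /(_ i (leqnn i))].
by rewrite raddf0 subr0 !rmorph1 => ?; exists i.
Qed.

Lemma frobenius_top_closure_sub
    (Mtop : sheafification (tensor_presheaf charR M))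
    (Ntop : sheafification (tensor_presheaf charR (submod_of N))) s :
  frobenius_top_closure Mtop Ntop s -> frobenius_closure charR N s.
Proof.
move=> [V [c [t _ ht]]]; apply: comparison_eq0.
pose Q := constant_presheaf eventual_quot.
have Q_sheaf : is_sheaf Q by exact: constant_presheaf_is_sheaf.
have [eta [eta_theta _]] := sheafify_univ Mtop Q_sheaf comparison_hom.
pose zero : presheaf_hom (tensor_presheaf charR (submod_of N)) Q :=
  @PresheafHom _ _ _ (tensor_presheaf charR (submod_of N)) Q (fun=> \0)
    (fun _ _ _ _ => erefl).
pose zero' : presheaf_hom Ntop Q :=
  @PresheafHom _ _ _ Ntop Q (fun=> \0) (fun _ _ _ _ => erefl).
set f := sheafify_map Ntop Mtop _ in t ht.
have [g [_ g_unique]] := sheafify_univ Ntop Q_sheaf zero.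
(* [eta] after [f] and [zero'] both extend the zero map on the presheaf of [N], so uniqueness
   identifies them. *)
have eta_f : eta V (f V t) = 0.
  rewrite -[LHS]/(presheaf_hom_comp eta f V t).
  rewrite (g_unique (presheaf_hom_comp eta f)).
    by rewrite -(g_unique zero').
  move=> U x; rewrite /= sheafify_mapE eta_theta.
  exact: comparison_submod.
have := eta_theta (site_top charR) (tens (site_str (site_top charR)) s 1).
(* Restriction in [Q] is the identity, so vanishing over [V] is vanishing over Spec R. *)
rewrite /= => <-; rewrite -eta_f ht /theta.
by rewrite (sect_map_restr eta c).
Qed.
End EventualQuotient.

(** * Finite subalgebras of eR as Frobenius covers *)

Section SubringType.
Variables (R : comNzRingType) (S : subringClosed R).

Record subring_of := SubringOf { subring_elt : R; _ : subring_elt \in S }.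

HB.instance Definition _ := [isSub for subring_elt].
HB.instance Definition _ := [Choice of subring_of by <:].
HB.instance Definition _ := [SubChoice_isSubComNzRing of subring_of by <:].

Definition subring_incl : {rmorphism subring_of -> R} := val.
End SubringType.

Section FiniteSubring.
Variables (p : nat) (R : comNzRingType) (charR : p \in [pchar R]) (e : nat).
Local Notation F := (frobenius_iter charR e).

(** For a subring [S]: it is an [R]-subalgebra of eR, finitely generated as an [R]-module. *)
Definition frobenius_finite (S : {pred R}) :=
  (forall r, F r \in S) /\
  exists (n : nat) (b : 'I_n -> R), (forall i, b i \in S) /\
    forall x, x \in S -> exists a : 'I_n -> R, x = \sum_(i < n) F (a i) * b i.

Section Adjoin.
Variables (S : subringClosed R) (x : R).

Definition adjoin : {pred R} :=
  fun y => `[< exists2 P : {poly R}, P \is a polyOver S & y = P.[x] >].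

Lemma adjoin_subring_closed : subring_closed adjoin.
Proof.
split=> [|_ _ /asboolP[P SP ->] /asboolP[Q SQ ->]|
         _ _ /asboolP[P SP ->] /asboolP[Q SQ ->]]; apply/asboolP.
- by exists 1; rewrite ?rpred1 ?hornerC.
- by exists (P - Q); rewrite ?rpredB ?hornerD ?hornerN.
- by exists (P * Q); rewrite ?rpredM ?hornerM.
Qed.

HB.instance Definition _ :=
  GRing.isSubringClosed.Build R adjoin adjoin_subring_closed.

Lemma adjoin_sub s : s \in S -> s \in adjoin.
Proof.
by move=> Ss; apply/asboolP; exists s%:P; rewrite ?polyOverC ?hornerC.
Qed.

Lemma adjoin_gen : x \in adjoin.
Proof. by apply/asboolP; exists 'X; rewrite ?polyOverX ?hornerX. Qed.

(* [x ^+ (p ^ e)] lies in the image of the Frobenius, hence in [S]. *)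
Lemma adjoin_powers y : (forall r, F r \in S) -> y \in adjoin ->
  exists s : 'I_(p ^ e) -> R,
    (forall j, s j \in S) /\ y = \sum_(j < p ^ e) s j * x ^+ j.
Proof.
move=> FS /asboolP[P /polyOverP SP ->]; set q := (p ^ e)%N.
have q_gt0 : (0 < q)%N by rewrite expn_gt0 (prime_gt0 (pcharf_prime charR)).
(* The terms of [P] are grouped by exponent modulo [q], and powers of [x ^+ q] go into the
   coefficients. *)
pose r (i : nat) : 'I_q := Ordinal (ltn_pmod i q_gt0).
exists (fun j =>
  \sum_(i < size P | r i == j) P`_i * (x ^+ q) ^+ (i %/ q)); split.
  move=> j; apply: rpred_sum => i _; apply: rpredM => //; apply: rpredX.
  by rewrite /q -(frobenius_iterE charR).
rewrite horner_coef (partition_big (r : 'I_(size P) -> _) predT) //=.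
apply: eq_bigr => j _; rewrite mulr_suml; apply: eq_bigr => i /eqP <- /=.
by rewrite -mulrA -exprM -exprD mulnC -divn_eq.
Qed.

(** The generators of [S] times the [x ^+ j] with [j < p ^ e] generate [adjoin] over [R]. *)
Lemma adjoin_finite : frobenius_finite S -> frobenius_finite adjoin.
Proof.
move=> [FS [n [b [Sb hb]]]]; split; first by move=> r; exact/adjoin_sub/FS.
exists #|{: 'I_n * 'I_(p ^ e)}|.
exists (fun k : 'I_#|{: 'I_n * 'I_(p ^ e)}| =>
  b (enum_val k).1 * x ^+ (enum_val k).2); split.
  by move=> k; rewrite rpredM ?rpredX ?adjoin_gen ?adjoin_sub.
move=> y /(adjoin_powers FS)[s [Ss ->]].
have /fin_all_exists[a ha] := fun j => hb _ (Ss j).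
exists (fun k => a (enum_val k).2 (enum_val k).1).
rewrite -(big_enum_val
  (fun k : 'I_n * 'I_(p ^ e) => F (a k.2 k.1) * (b k.1 * x ^+ k.2))) /=.
rewrite -(pair_bigA _ (fun i j => F (a j i) * (b i * x ^+ j))) /=.
rewrite exchange_big; apply: eq_bigr => j _; rewrite ha mulr_suml.
by apply: eq_bigr => i _; rewrite mulrA.
Qed.
End Adjoin.

Definition frobenius_image : {pred R} := fun y => `[< exists r, y = F r >].

Lemma frobenius_image_subring_closed : subring_closed frobenius_image.
Proof.
split=> [|_ _ /asboolP[r ->] /asboolP[s ->]|_ _ /asboolP[r ->] /asboolP[s ->]];
  apply/asboolP.
- by exists 1; rewrite rmorph1.
- by exists (r - s); rewrite rmorphB.
- by exists (r * s); rewrite rmorphM.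
Qed.

HB.instance Definition _ :=
  GRing.isSubringClosed.Build R frobenius_image frobenius_image_subring_closed.

(** Start from the image of the Frobenius, generated by 1, and adjoin the elements one by one. *)
Lemma frobenius_finite_subring (xs : seq R) :
  exists S : subringClosed R, frobenius_finite S /\ {subset xs <= S}.
Proof.
elim: xs => [|x xs [S [Sfin xsS]]].
  exists (GRing.SubringClosed.clone R frobenius_image _); split=> //.
  split=> [r|]; first by apply/asboolP; exists r.
  exists 1, (fun=> 1); split=> [_|_ /asboolP[r ->]]; first exact: rpred1.
  by exists (fun=> r); rewrite big_ord1 mulr1.
exists (GRing.SubringClosed.clone R (adjoin S x) _).
split; first exact: adjoin_finite.
move=> y; rewrite inE => /orP[/eqP ->|/xsS]; first exact: adjoin_gen.
exact: adjoin_sub.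
Qed.

Section Cover.
Variable S : subringClosed R.
Hypothesis Sfin : frobenius_finite S.

Definition frobenius_to (r : R) : subring_of S := SubringOf (Sfin.1 r).

Lemma frobenius_to_is_zmod_morphism : zmod_morphism frobenius_to.
Proof. by move=> x y; apply: val_inj; rewrite /= rmorphB. Qed.

Lemma frobenius_to_is_monoid_morphism : monoid_morphism frobenius_to.
Proof.
split; first by apply: val_inj; rewrite /= rmorph1.
by move=> x y; apply: val_inj; rewrite /= rmorphM.
Qed.

HB.instance Definition _ := GRing.isZmodMorphism.Build R (subring_of S)
  frobenius_to frobenius_to_is_zmod_morphism.
HB.instance Definition _ := GRing.isMonoidMorphism.Build R (subring_of S)
  frobenius_to frobenius_to_is_monoid_morphism.

(* The prime of [R] over a prime [Q] of the subring is
   [{r | r ^+ (p ^ e) \in Q}]. *)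
Lemma subring_incl_surjective : spec_surjective (subring_incl S).
Proof.
move=> Q; pose P : {pred R} := fun r => frobenius_to r \in Q.
have PE r : (r \in P) = (frobenius_to r \in Q) by [].
have P_ideal : idealr_closed P.
  split; first by rewrite PE rmorph0 rpred0.
    by rewrite PE rmorph1 idealr1.
  move=> a u v; rewrite !PE => Qu Qv.
  by rewrite rmorphD rmorphM rpredD // idealMr.
have P_prime : prime_idealr_closed P.
  by move=> u v; rewrite !PE rmorphM prime_idealrM.
exists (HB.pack_for (prime_idealr R) P (isIdealr.Build R P P_ideal)
  (isPrimeIdealrClosed.Build R P P_prime)).
move=> x; have p_gt0 := prime_gt0 (pcharf_prime charR).
have -> : (subring_incl S x \in P) = (x ^+ (p ^ e) \in Q).
  rewrite PE; congr (_ \in Q); apply: val_inj.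
  by rewrite -[RHS]/(subring_incl S (x ^+ _)) rmorphXn -(frobenius_iterE charR).
have : (0 < p ^ e)%N by rewrite expn_gt0 p_gt0.
elim: (p ^ e)%N => // -[|n] IHn _; first by rewrite expr1.
by rewrite exprS prime_idealrM -IHn // orbb.
Qed.

(** [charR'] is arbitrary so that the lemma serves both the object, with [charR], and the morphism
    to [site_top], with [site_char]. *)
Lemma frobenius_to_cover (charR' : p \in [pchar R]) :
  finite_frobenius_cover charR' frobenius_to.
Proof.
split; last first.
  exists e, (subring_incl S); split=> [a|]; last exact: subring_incl_surjective.
  by rewrite (bool_irrelevance charR' charR).
have [_ [n [b [Sb hb]]]] := Sfin.
exists n, (fun i => SubringOf (Sb i)) => x.
have [a xE] := hb _ (valP x); exists a; apply: val_inj; rewrite [LHS]xE.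
by rewrite -/(subring_incl S) rmorph_sum.
Qed.

Definition frobenius_site_obj : site_obj charR :=
  SiteObj (frobenius_to_cover charR).

Definition frobenius_site_hom : site_hom frobenius_site_obj (site_top charR) :=
  @SiteHom _ _ charR frobenius_site_obj (site_top charR) frobenius_to
    (fun=> erefl) (frobenius_to_cover _).
End Cover.
End FiniteSubring.

(** * Descent of relations; the Frobenius closure lies in the topological one *)

Section Descent.
Variables (p : nat) (R : comNzRingType) (charR : p \in [pchar R]) (e : nat).
Local Notation F := (frobenius_iter charR e).

Section Retract.
Variables (M : lmodType R) (S : subringClosed R).
Hypothesis Sfin : frobenius_finite charR e S.

(** The default 0 outside [S] need not be additive in [r], so [retract] is defined on the free group
    and respects only relations with scalars in [S]. *)
Definition retract_gen (m : M) (r : R) : tensor M (frobenius_to Sfin) :=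
  if insub r is Some s then tens (frobenius_to Sfin) m s else 0.

Definition retract :
    {additive {freeg (M * R)%type / int} -> tensor M (frobenius_to Sfin)} :=
  free_lift retract_gen.

Lemma retractE m r (Sr : r \in S) :
  retract << (m, r) >> = tens (frobenius_to Sfin) m (SubringOf Sr).
Proof. by rewrite /= free_lift_gen /retract_gen insubT. Qed.
End Retract.

(* The subring only has to contain the finitely many scalars that occur in a
   derivation of the relation. *)
Lemma retract_rel (M : lmodType R) (x : {freeg (M * R)%type / int}) :
  @tensor_rel R M R F x ->
  exists xs : seq R, forall (S : subringClosed R)
    (Sfin : frobenius_finite charR e S),
    {subset xs <= S} -> retract M Sfin x = 0.
Proof.
elim=> [|{}x y _ [xs hx] _ [ys hy]|m m' s|m s s'|r m s].
- by exists [::] => S Sfin _; rewrite raddf0.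
- exists (xs ++ ys) => S Sfin xysS.
  by rewrite raddfB hx ?hy ?subrr // => z zs;
    apply: xysS; rewrite mem_cat zs ?orbT.
- exists [:: s] => S Sfin sS; have Ss : s \in S by rewrite sS ?mem_head.
  by rewrite !raddfB !(retractE _ _ Ss) tensDl addrAC addrK subrr.
- exists [:: s; s'] => S Sfin sS; have Ss : s \in S by rewrite sS ?mem_head.
  have Ss' : s' \in S by rewrite sS // !inE eqxx orbT.
  rewrite !raddfB (retractE _ _ (rpredD Ss Ss')).
  rewrite (retractE _ _ Ss) (retractE _ _ Ss').
  rewrite (_ : SubringOf _ = SubringOf Ss + SubringOf Ss'); last exact: val_inj.
  by rewrite tensDr addrAC addrK subrr.
- exists [:: s] => S Sfin sS; have Ss : s \in S by rewrite sS ?mem_head.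
  have SFs := rpredM (Sfin.1 r) Ss.
  rewrite raddfB (retractE _ _ Ss) (retractE _ _ SFs) tensZ.
  by rewrite (_ : SubringOf SFs = frobenius_to Sfin r * SubringOf Ss) ?subrr //;
    exact: val_inj.
Qed.

Variables (M : lmodType R) (N : submodClosed M).

Lemma frobenius_image_descends s :
  range (frobenius_incl charR N e) (tens F s 1) ->
  exists (S : subringClosed R) (Sfin : frobenius_finite charR e S),
    range (tensor_presheaf_map charR (submod_incl N) (frobenius_site_obj Sfin))
      (tens (frobenius_to Sfin) s 1).
Proof.
move=> [t _ ht]; have [y ty] := tensor_pi_surj t.
(* [push] lifts [frobenius_incl] to representatives, so that [ht] becomes one relation in the free
   group. *)
pose push : {additive {freeg (submod_of N * R)%type / int} ->
    {freeg (M * R)%type / int}} :=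
  free_lift (fun n r =>
    << (submod_incl N n, r) >> : {freeg (M * R)%type / int}).
have push_gen n r : push << (n, r) >> = << (submod_incl N n, r) >>.
  exact: free_lift_gen.
have push_pi : tensor_pi M F (push y) = frobenius_incl charR N e t.
  rewrite ty; apply: (free_eq_morph (f := tensor_pi M F \o push)
    (g := frobenius_incl charR N e \o tensor_pi (submod_of N) F)) => n r /=.
  by rewrite push_gen; apply/esym; exact: tensor_map_tens.
have [xs xs_retract] : exists xs : seq R, forall (S : subringClosed R)
    (Sfin : frobenius_finite charR e S), {subset xs <= S} ->
    retract M Sfin (push y - << (s, 1) >>) = 0.
  by apply/retract_rel/tensor_pi_eq; rewrite push_pi ht.
have [S [Sfin xsS]] := frobenius_finite_subring charR e xs.
exists S, Sfin; exists (retract (submod_of N) Sfin y) => //.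
have := xs_retract S Sfin xsS; rewrite raddfB (retractE _ _ (rpred1 S)).
move/eqP; rewrite subr_eq0 (_ : SubringOf _ = 1); last exact: val_inj.
move=> /eqP <-.
apply: (free_eq_morph
  (f := tensor_presheaf_map charR (submod_incl N) (frobenius_site_obj Sfin)
        \o retract (submod_of N) Sfin)
  (g := retract M Sfin \o push)) => n r.
rewrite -[LHS]/(tensor_presheaf_map charR (submod_incl N)
  (frobenius_site_obj Sfin) (retract _ Sfin << (n, r) >>)).
rewrite -[RHS]/(retract M Sfin (push << (n, r) >>)) push_gen.
(* Terms of [y] with scalar outside [S] go to 0 on both sides, so the square commutes on all
   generators. *)
have [Sr|nSr] := boolP (r \in S).
  by rewrite !(retractE _ _ Sr); exact: tensor_presheaf_map_tens.
by rewrite /retract /= !free_lift_gen /retract_gen insubN // raddf0.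
Qed.

(** Over the single covering Spec S the element comes from the presheaf of [N], and sheafification
    is natural. *)
Lemma sub_frobenius_top_closure
    (Mtop : sheafification (tensor_presheaf charR M))
    (Ntop : sheafification (tensor_presheaf charR (submod_of N))) s :
  range (frobenius_incl charR N e) (tens F s 1) ->
  frobenius_top_closure Mtop Ntop s.
Proof.
move=> /frobenius_image_descends[S [Sfin [n _ hn]]].
set V := frobenius_site_obj Sfin in n hn.
exists V, (frobenius_site_hom Sfin), (sheafify Ntop V n) => //.
rewrite sheafify_mapE hn /theta -sect_map_restr; congr (sheafify Mtop V _).
rewrite [RHS](tensor_map_tens idfun) /=; congr tens.
by rewrite rmorph1.
Qed.
End Descent.

Theorem proposition4p2p3 (k : fieldType) (p : nat) (chark : p \in [pchar k])
  (R : comNzRingType) (iota : {rmorphism k -> R})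
  (M : lmodType R) (N : submodClosed M)
  (Mtop : sheafification (tensor_presheaf (rmorph_pchar iota chark) M))
  (Ntop : sheafification
            (tensor_presheaf (rmorph_pchar iota chark) (submod_of N))) :
  frobenius_closure (rmorph_pchar iota chark) N =
  frobenius_top_closure Mtop Ntop.
Proof.
apply/funext => s; apply/propext; split; last exact: frobenius_top_closure_sub.
by move=> [e he]; apply: sub_frobenius_top_closure he.
Qed.
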